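(* Let $G$ be a graph with $m$ edges and $t$ $6$-cycles, with maximum degree $\Delta(G)\le m^{2/5}$. Then the number of capped $3$-walks in $G$ is at most $\widetilde{O}(m^{1.6}+t)$.
   Context: Fix a total order $\succ$ on the vertices of $G$ such that $u\succ w$ whenever $\deg(u)>\deg(w)$ (ties broken arbitrarily). A $3$-walk is a walk $x_0,x_1,x_2,x_3$ with $3$ edges; it is capped if $x_0\succ x_i$ for $i=1,2,3$. $\widetilde{O}$ hides factors polylogarithmic in the number of vertices $n$ (with $m\ge n$). *)

(* Defs.v *)
From mathcomp Require Import all_boot all_order all_algebra.
From mathcomp Require Import reals exp.
Set Implicit Arguments.
Unset Strict Implicit.
Unset Printing Implicit Defensive.

Definition simple_graph (V : finType) (e : rel V) : Prop :=
  symmetric e /\ irreflexive e.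

Definition edges (V : finType) (e : rel V) : {set {set V}} :=
  [set [set p.1; p.2] | p : V * V & e p.1 p.2].

Definition deg (V : finType) (e : rel V) (x : V) : nat := #|[set y | e x y]|.

Definition max_deg (V : finType) (e : rel V) : nat := \max_(x : V) deg e x.

(* [gt u w] stands for u \succ w. *)
Definition strict_total_order (V : finType) (gt : rel V) : Prop :=
  [/\ irreflexive gt, transitive gt
    & forall u w : V, u != w -> gt u w || gt w u].

Definition degree_ordering (V : finType) (e gt : rel V) : Prop :=
  strict_total_order gt /\ forall u w : V, deg e w < deg e u -> gt u w.

(* For a duplicate-free [c], the edges of the closed walk through [c]. *)
Definition cycle_edges (V : finType) (c : seq V) : {set {set V}} :=
  [set [set x; next c x] | x in c].

(* A 6-cycle is counted as a subgraph, identified with its edge set, so the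
   12 rooted oriented traversals of one cycle are counted once. *)
Definition six_cycles (V : finType) (e : rel V) : {set {set {set V}}} :=
  [set cycle_edges c | c : 6.-tuple V & ucycleb e c].

Definition capped_3walks (V : finType) (e gt : rel V) : {set 4.-tuple V} :=
  [set x : 4.-tuple V | sorted e x && all (gt (thead x)) (behead x)].

(* Main.v *)
Require Import Defs.
From mathcomp Require Import all_boot all_order all_algebra.
From mathcomp Require Import reals exp.
From mathcomp Require Import ring lra zify.
Set Implicit Arguments.
Unset Strict Implicit.
Unset Printing Implicit Defensive.
Import Order.TTheory GRing.Theory Num.Theory.
Local Open Scope ring_scope.

(* Put [q = m^(1/5)] and let [S x] be the sum of [sqrt (deg y)] over the
   neighbours [y] of [x]. Since a cap [x0] has degree at least that of [x2], the
   capped 3-walks number at most the sum of [S x ^ 2] over the middle vertices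
   [x = x1]. The light vertices, those with [S x ^ 2 < q^3 deg x], contribute at
   most [2 q^3 m = 2 q^8].

   Let [W] be the sum of [S x ^ 2] over the heavy vertices, [E] the number of
   edges leaving them (so [q^3 E <= W]), and [H] (resp. [Q]) the number of
   closed 6-walks (resp. 4-walks) whose odd vertices are heavy. [W] is the
   value at the vector [sqrt (deg y)], of squared norm [2m], of a positive
   semidefinite form whose cube has trace [H], whence [W^3 <= (2m)^3 H]. A
   degenerate closed 6-walk has one of nine coincidences, each occurring in
   at most [D Q] walks with [D <= q^2] the maximum degree, and [Q^2 <= E H]
   by Cauchy-Schwarz. By AM-GM, [H] is at most a constant times [t + D^2 E],
   where [t] is the number of 6-cycles. Since [D^2 E <= q W], this gives
   [W^3 = O(q^15 t + q^16 W)], hence [W = O(q^8 + t)], with no logarithmic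
   factor. *)

Lemma sum_mulA (R : pzSemiRingType) (I J : finType)
    (f : I -> R) (g : I -> J -> R) (h : J -> R) :
  \sum_i f i * (\sum_j g i j * h j) = \sum_j (\sum_i f i * g i j) * h j.
Proof.
under eq_bigr do rewrite mulr_sumr.
under [RHS]eq_bigr do rewrite mulr_suml.
rewrite exchange_big /=.
by do 2![apply: eq_bigr => ? _]; rewrite mulrA.
Qed.

Lemma sum_Cauchy_Schwarz (R : realDomainType) (I : finType) (a b : I -> R) :
  (\sum_i a i * b i) ^+ 2 <= (\sum_i a i ^+ 2) * (\sum_i b i ^+ 2).
Proof.
have prod_eq : (\sum_i a i * b i) ^+ 2 *+ 2 =
    \sum_i \sum_j (a i * b j) * (a j * b i) *+ 2.
  rewrite expr2 big_distrlr -sumrMnl; apply: eq_bigr => i _.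
  by rewrite -sumrMnl; apply: eq_bigr => j _ /=; ring.
have sqr_eq : (\sum_i a i ^+ 2) * (\sum_i b i ^+ 2) *+ 2 =
    \sum_i \sum_j ((a i * b j) ^+ 2 + (a j * b i) ^+ 2).
  rewrite big_distrlr mulr2n {2}exchange_big -big_split; apply: eq_bigr => i _.
  by rewrite -big_split; apply: eq_bigr => j _ /=; rewrite !exprMn.
rewrite -(ler_pMn2r (isT : (0 < 2)%N)) prod_eq sqr_eq.
by do 2![apply: ler_sum => ? _]; rewrite leif_mean_square_scaled.
Qed.

Lemma sum_Cauchy_Schwarz_nat (I : finType) (a b : I -> nat) :
  ((\sum_i a i * b i) ^ 2 <= (\sum_i a i ^ 2) * (\sum_i b i ^ 2))%N.
Proof.
rewrite -(ler_nat int) natrX natrM !natr_sum.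
under eq_bigr do rewrite natrM.
under [X in _ <= X * _]eq_bigr do rewrite natrX.
under [X in _ <= _ * X]eq_bigr do rewrite natrX.
exact: sum_Cauchy_Schwarz.
Qed.

Lemma leq_double_of_sqr (x u v : nat) : (x ^ 2 <= u * v -> 2 * x <= u + v)%N.
Proof.
move=> le_x_uv; rewrite -leq_sqr expnMn.
by apply: leq_trans (nat_AGM2 u v); rewrite leq_mul2l.
Qed.

Lemma cube_le_cubic_form (R : realDomainType) (W s b c k : R) :
  0 <= s -> 0 <= b -> 0 < k -> b + c * k <= k ^+ 3 ->
  W ^+ 3 <= b * s ^+ 3 + c * s ^+ 2 * W -> W <= k * s.
Proof.
move=> s_ge0 b_ge0 k_gt0 le_k3 le_W3; rewrite leNgt; apply/negP => lt_W.
have ks_ge0 : 0 <= k * s by rewrite mulr_ge0 // ltW.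
have W_gt0 : 0 < W by apply: le_lt_trans lt_W.
have : 0 < k * W * (W ^+ 2 - (k * s) ^+ 2).
  by rewrite !mulr_gt0 // subr_gt0 ltrXn2r.
apply/negP; rewrite -leNgt.
apply: (@le_trans _ _ (b * s ^+ 2 * (k * s - W))); last first.
  by rewrite mulr_ge0_le0 ?mulr_ge0 ?exprn_ge0 // subr_le0 ltW.
have le_kW3 := ler_wpM2l (ltW k_gt0) le_W3.
have le_k3sW := ler_wpM2r (mulr_ge0 (exprn_ge0 2 s_ge0) (ltW W_gt0)) le_k3.
by lra.
Qed.

Lemma sum_sqr_kernel_le (R : realDomainType) (I J : finType)
    (A : I -> J -> R) (w : J -> R) :
  \sum_i (\sum_j A i j * w j) ^+ 2 <=
  (\sum_i \sum_j A i j ^+ 2) * \sum_j w j ^+ 2.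
Proof.
by rewrite mulr_suml; apply: ler_sum => i _; apply: sum_Cauchy_Schwarz.
Qed.

Section KernelCube.

Variables (R : realDomainType) (I J : finType) (A : I -> J -> R) (w : J -> R).

(* The kernel of [A A^T A]. *)
Definition triple_kernel (i : I) (j : J) : R :=
  \sum_i' (\sum_j' A i j' * A i' j') * A i' j.

(* For [M = A^T A] this reads [<w, M w> ^ 3 <= |w| ^ 6 * tr (M ^ 3)]. *)
Lemma sum_sqr_kernel_cube_le :
  (\sum_i (\sum_j A i j * w j) ^+ 2) ^+ 3 <=
  (\sum_j w j ^+ 2) ^+ 3 * \sum_i \sum_j triple_kernel i j ^+ 2.
Proof.
pose S i := \sum_j A i j * w j.
pose g j := \sum_i A i j * S i.
pose h i := \sum_j A i j * g j.
set W := \sum_i S i ^+ 2; set n := \sum_j w j ^+ 2.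
set H := \sum_i \sum_j triple_kernel i j ^+ 2.
have sumsq_ge0 (T : finType) (f : T -> R) : 0 <= \sum_t f t ^+ 2.
  by apply: sumr_ge0 => t _; apply: sqr_ge0.
have W_ge0 : 0 <= W by apply: sumsq_ge0.
have n_ge0 : 0 <= n by apply: sumsq_ge0.
have W_eq : W = \sum_j w j * g j.
  rewrite [RHS]sum_mulA; apply: eq_bigr => i _; rewrite expr2.
  by congr (_ * _); apply: eq_bigr => j _; rewrite mulrC.
have g_eq : \sum_j g j ^+ 2 = \sum_i S i * h i.
  rewrite [RHS]sum_mulA; apply: eq_bigr => j _; rewrite expr2.
  by congr (_ * _); apply: eq_bigr => i _; rewrite mulrC.
have h_eq i : h i = \sum_j triple_kernel i j * w j.
  by rewrite /h [LHS]sum_mulA -[RHS]sum_mulA.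
have le_W : W ^+ 2 <= n * \sum_j g j ^+ 2.
  by rewrite W_eq; apply: sum_Cauchy_Schwarz.
have le_g : (\sum_j g j ^+ 2) ^+ 2 <= W * \sum_i h i ^+ 2.
  by rewrite g_eq; apply: sum_Cauchy_Schwarz.
have le_h : \sum_i h i ^+ 2 <= H * n.
  by under eq_bigr do rewrite h_eq; apply: sum_sqr_kernel_le.
have [->|W_neq0] := eqVneq W 0.
  rewrite expr0n mulr_ge0 ?exprn_ge0 //.
  by apply: sumr_ge0 => i _; apply: sumsq_ge0.
have W_gt0 : 0 < W by rewrite lt_def W_neq0.
rewrite -(ler_pM2l W_gt0) -exprS (exprM W 2 2).
have -> : W * (n ^+ 3 * H) = n ^+ 2 * (W * (H * n)) by ring.
apply: (@le_trans _ _ ((n * \sum_j g j ^+ 2) ^+ 2)).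
  by rewrite lerXn2r // nnegrE ?mulr_ge0 ?exprn_ge0.
rewrite exprMn ler_wpM2l ?exprn_ge0 //; apply: le_trans le_g _.
by rewrite ler_wpM2l.
Qed.

End KernelCube.

Lemma card_set_sum (T : finType) (P : pred T) :
  #|[set x | P x]| = (\sum_x P x)%N.
Proof.
rewrite -sum1dep_card big_mkcond; apply: eq_bigr => x _.
by case: (P x).
Qed.

Lemma card_set_pair (T U : finType) (F : T -> pred U) :
  #|[set z : T * U | F z.1 z.2]| = (\sum_t #|[set u | F t u]|)%N.
Proof.
rewrite -sum1dep_card -(pair_big_dep xpredT F (fun _ _ => 1%N)) /=.
by apply: eq_bigr => t _; rewrite sum1dep_card.
Qed.

Lemma card_set_pair_sqr (T U : finType) (F : T -> {set U}) :
  #|[set z : T * (U * U) | (z.2.1 \in F z.1) && (z.2.2 \in F z.1)]| =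
  (\sum_t #|F t| ^ 2)%N.
Proof.
rewrite (card_set_pair (fun t r => (r.1 \in F t) && (r.2 \in F t))).
apply: eq_bigr => t _; rewrite -mulnn -cardsX.
by apply: eq_card => r; rewrite !inE.
Qed.

Lemma leq_card_set_pair (T U : finType) (S : {set T}) (F : T -> pred U)
    (k : nat) :
  (forall t, #|[set u | F t u]| <= k)%N ->
  (#|[set z : T * U | (z.1 \in S) && F z.1 z.2]| <= k * #|S|)%N.
Proof.
move=> leFk; rewrite (card_set_pair (fun t u => (t \in S) && F t u)).
rewrite mulnC -sum_nat_const [leqRHS]big_mkcond /=.
apply: leq_sum => t _; case: (t \in S) => //=.
by rewrite eq_card0 // => u; rewrite inE.
Qed.

Lemma leq_card_surj_in (T U : finType) (f : T -> U) (D : {set T})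
    (E : {set U}) :
  (forall u, u \in E -> exists2 t, t \in D & u = f t) -> (#|E| <= #|D|)%N.
Proof.
move=> surj_f; apply: leq_trans (leq_imset_card f D).
by apply/subset_leq_card/subsetP => u /surj_f /imsetP.
Qed.

Lemma leq_card_fibers (T U : finType) (f : T -> U) (D : {set T}) (k : nat) :
  (forall x, x \in D -> #|[set z in D | f z == f x]| <= k)%N ->
  (#|D| <= k * #|f @: D|)%N.
Proof.
move=> fib; rewrite -sum1_card (partition_big_imset f) /= mulnC -sum_nat_const.
apply: leq_sum => _ /imsetP[x Dx ->]; apply: leq_trans (fib x Dx).
by rewrite sum1dep_card.
Qed.

Lemma leq_card_tuples_in (T : finType) (n : nat) (Z : {set T}) :
  (#|[set c : n.-tuple T | all (mem Z) c]| <= #|Z| ^ n)%N.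
Proof.
rewrite -[n in (_ ^ n)%N]card_ord -(card_ffun_on _ (mem Z)) -[leqRHS]cardsE.
pose tuple_of_ffun (g : {ffun 'I_n -> T}) := [tuple g i | i < n].
apply: (leq_card_surj_in (f := tuple_of_ffun)) => c.
rewrite inE => /allP cZ; exists [ffun i => tnth c i].
  by rewrite inE; apply/ffun_onP => i; rewrite ffunE; apply/cZ/mem_tnth.
by apply: eq_from_tnth => i; rewrite tnth_mktuple ffunE.
Qed.

Lemma cover_cycle_edges (V : finType) (c : seq V) :
  cover (cycle_edges c) = [set x in c].
Proof.
apply/setP => x; rewrite inE; apply/bigcupP/idP => [[_ /imsetP[y yc ->]]|xc].
  by rewrite !inE => /orP[]/eqP-> //; rewrite mem_next.
by exists [set x; next c x]; [apply: imset_f | rewrite !inE eqxx].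
Qed.

Lemma leq_card_cycle_edges (V : finType) (n : nat) (D : {set n.-tuple V}) :
  (#|D| <= n ^ n * #|[set cycle_edges c | c : n.-tuple V in D]|)%N.
Proof.
apply: leq_card_fibers => c _.
apply: (@leq_trans #|[set z : n.-tuple V | all (mem [set x in c]) z]|).
  apply/subset_leq_card/subsetP => z; rewrite !inE => /andP[_ /eqP eq_zc].
  apply/allP => x xz; rewrite /= -cover_cycle_edges -eq_zc cover_cycle_edges.
  by rewrite inE.
apply: leq_trans (leq_card_tuples_in _ _) _.
have le_cn : (#|[set x in c]| <= n)%N.
  by rewrite cardsE -[leqRHS](size_tuple c) card_size.
by case: n {D} c le_cn => // n c; rewrite leq_exp2r.
Qed.

Lemma card_ucycles6_le (V : finType) (e : rel V) :
  (#|[set c : 6.-tuple V | ucycleb e c]| <= 6 ^ 6 * #|six_cycles e|)%N.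
Proof.
apply: leq_trans (leq_card_cycle_edges _) _; rewrite leq_mul2l.
apply/orP; right; apply/subset_leq_card/subsetP => E /imsetP[c].
by rewrite inE => c_cycle ->; apply/imsetP; exists c; rewrite ?inE.
Qed.

Lemma sum_deg_le_edges (V : finType) (e : rel V) :
  (\sum_x deg e x <= 2 * #|edges e|)%N.
Proof.
rewrite -(card_set_pair e).
apply: leq_card_fibers => -[x y] _ /=.
apply: (@leq_trans #|[set (x, y); (y, x)]|); last by rewrite cards2; case: eqP.
apply: subset_leq_card; apply/subsetP => -[u v]; rewrite !inE /=.
case/andP=> _ /eqP/setP eq_uv_xy.
have := eq_uv_xy u; have := eq_uv_xy v; have := eq_uv_xy x; have := eq_uv_xy y.
rewrite !inE !eqxx ?orbT !xpair_eqE /=.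
rewrite (eq_sym x u) (eq_sym x v) (eq_sym y u) (eq_sym y v).
by case: (u == x); case: (u == y); case: (v == x); case: (v == y).
Qed.

Section ClosedWalks.

Variables (V : finType) (a : rel V).

(* [a x y] is read as an edge between the odd vertex [x] and the even vertex
   [y] of a bipartite graph with two copies of [V] as its sides. The closed walk
   [x1, y1, x2, y2, ..] is encoded as [((x1, y1), (x2, y2), ..)]. *)
Local Notation walk4 := ((V * V) * (V * V))%type.
Local Notation walk6 := ((V * V) * (V * V) * (V * V))%type.

Definition alternating : rel (V * V) := fun p q => a p.1 p.2 && a q.1 p.2.

Definition closed_walks4 : {set walk4} :=
  [set c | alternating c.1 c.2 && alternating c.2 c.1].

Definition closed_walks6 : {set walk6} :=
  [set c | [&& alternating c.1.1 c.1.2, alternating c.1.2 c.2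
             & alternating c.2 c.1.1]].

Definition common_nbrs (x x' : V) : {set V} := [set y | a x y && a x' y].

(* The walks [x, r.1, r.2, u]. *)
Definition walks3 (x u : V) : {set V * V} :=
  [set r | [&& a x r.1, a r.2 r.1 & a r.2 u]].

Lemma card_closed_walks4 :
  #|closed_walks4| = (\sum_x \sum_x' #|common_nbrs x x'| ^ 2)%N.
Proof.
rewrite pair_bigA -(card_set_pair_sqr (fun t => common_nbrs t.1 t.2)).
pose ends_mids (c : walk4) := ((c.1.1, c.2.1), (c.1.2, c.2.2)).
have ends_mids_bij : bijective ends_mids.
  by exists ends_mids => -[[? ?] [? ?]].
rewrite -(on_card_preimset (onW_bij _ ends_mids_bij)).
apply: eq_card => -[[x y] [x' y']]; rewrite !inE /alternating /=.
by rewrite (andbC (a x' y')).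
Qed.

Lemma card_closed_walks6 :
  #|closed_walks6| = (\sum_x \sum_u #|walks3 x u| ^ 2)%N.
Proof.
rewrite pair_bigA -(card_set_pair_sqr (fun t => walks3 t.1 t.2)).
pose ends_mids (c : walk6) :=
  ((c.1.1.1, c.1.2.2), ((c.1.1.2, c.1.2.1), (c.2.2, c.2.1))).
have ends_mids_bij : bijective ends_mids.
  exists (fun z => (((z.1.1, z.2.1.1), (z.2.1.2, z.1.2)), (z.2.2.2, z.2.2.1))).
    by move=> [[[? ?] [? ?]] [? ?]].
  by move=> [[? ?] [[? ?] [? ?]]].
rewrite -(on_card_preimset (onW_bij _ ends_mids_bij)).
apply: eq_card => -[[[x1 y1] [x2 y2]] [x3 y3]]; rewrite !inE /alternating /=.
by rewrite -!andbA; do 3![congr andb]; do 3!case: (a _ _).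
Qed.

Lemma card_common_nbrs (x x' : V) :
  #|common_nbrs x x'| = (\sum_y a x y * a x' y)%N.
Proof. by rewrite card_set_sum; apply: eq_bigr => y _; rewrite mulnb. Qed.

Lemma card_walks3 (x u : V) :
  #|walks3 x u| = (\sum_x' #|common_nbrs x x'| * a x' u)%N.
Proof.
have -> : #|walks3 x u| =
    #|[set r : V * V | (r.2 \in common_nbrs x r.1) && a r.1 u]|.
  pose swap (r : V * V) := (r.2, r.1).
  have swap_bij : bijective swap by exists swap => -[].
  rewrite -(on_card_preimset (onW_bij _ swap_bij)).
  by apply: eq_card => -[y x']; rewrite !inE /= andbA.
rewrite (card_set_pair (fun x' y => (y \in common_nbrs x x') && a x' u)).
apply: eq_bigr => x' _; case: (a x' u); rewrite ?muln0 ?muln1.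
  by apply: eq_card => y; rewrite !inE andbT.
by apply: eq_card0 => y; rewrite inE andbF.
Qed.

Lemma card_closed_walks4_walks3 :
  #|closed_walks4| = (\sum_x \sum_u a x u * #|walks3 x u|)%N.
Proof.
rewrite card_closed_walks4; apply: eq_bigr => x _.
under [RHS]eq_bigr do rewrite card_walks3 big_distrr.
rewrite exchange_big /=; apply: eq_bigr => x' _.
under eq_bigr do rewrite mulnCA.
by rewrite -big_distrr -card_common_nbrs -mulnn.
Qed.

Lemma card_closed_walks4_sqr_le :
  (#|closed_walks4| ^ 2 <= (\sum_x deg a x) * #|closed_walks6|)%N.
Proof.
rewrite card_closed_walks4_walks3 card_closed_walks6 !pair_bigA /=.
apply: leq_trans (sum_Cauchy_Schwarz_nat _ _) _; rewrite leq_mul2r.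
apply/orP; right; rewrite -(card_set_pair a) card_set_sum.
by apply: leq_sum => t _; case: (a t.1 t.2).
Qed.

Definition rot_walk6 (c : walk6) : walk6 := (c.1.2, c.2, c.1.1).

Definition walk6_vertices (c : walk6) : 6.-tuple V :=
  let: ((x1, y1), (x2, y2), (x3, y3)) := c in [tuple x1; y1; x2; y2; x3; y3].

Lemma walk6_vertices_inj : injective walk6_vertices.
Proof.
move=> [[[x1 y1] [x2 y2]] [x3 y3]] [[[x1' y1'] [x2' y2']] [x3' y3']].
by move/(congr1 val) => [-> -> -> -> -> ->].
Qed.

(* Up to rotation, any two vertices of a closed 6-walk not joined by an edge are
   one of these three pairs. *)
Definition coincident (c : walk6) : bool :=
  let: ((x1, y1), (x2, y2), _) := c in [|| x1 == x2, y1 == y2 | x1 == y2].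

Lemma rot_closed_walks6 c :
  (rot_walk6 c \in closed_walks6) = (c \in closed_walks6).
Proof. by rewrite !inE /= andbA andbC. Qed.

Lemma rot_walk6_inj : injective rot_walk6.
Proof. by move=> [[p q] r] [[p' q'] r'] [-> -> ->]. Qed.

Lemma closed_walks6_not_uniq c :
  irreflexive a ->
  c \in closed_walks6 -> ~~ uniq (walk6_vertices c) ->
  [|| coincident c, coincident (rot_walk6 c)
    | coincident (rot_walk6 (rot_walk6 c))].
Proof.
move=> irr_a; have neq x y : a x y -> (x == y) = false.
  by move=> axy; apply/eqP => eq_xy; rewrite eq_xy irr_a in axy.
case: c => [[[x1 y1] [x2 y2]] [x3 y3]].
rewrite !inE /alternating /coincident /= !inE.
case/and3P=> /andP[/neq n11 /neq n21] /andP[/neq n22 /neq n32].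
case/andP=> [/neq n33 /neq n13].
rewrite (eq_sym y1 x2) (eq_sym y2 x3) n11 n21 n22 n32 n33 n13.
rewrite (eq_sym x3 x1) (eq_sym y3 y1) (eq_sym x2 y3) (eq_sym x3 y1).
by do 9?case: eqP => //=.
Qed.

Section BoundedDegree.

Variable D : nat.
Hypothesis outdeg_le : forall x, (deg a x <= D)%N.
Hypothesis indeg_le : forall y, (#|[set x | a x y]| <= D)%N.

Lemma card_closed_walks6_eq_odd :
  (#|[set c in closed_walks6 | c.1.1.1 == c.1.2.1]| <= D * #|closed_walks4|)%N.
Proof.
apply: leq_trans (leq_card_set_pair closed_walks4
  (fun c => outdeg_le c.1.1)).
apply: (leq_card_surj_in (f := fun z : walk4 * V =>
  (((z.1.1.1, z.2), z.1.1), z.1.2))) => -[[[x1 y1] [x2 y2]] [x3 y3]].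
rewrite !inE /alternating /= => /andP[+ /eqP eq_x]; rewrite eq_x.
case/and3P=> /andP[a11 _] a2 a3.
by exists (((x2, y2), (x3, y3)), y1); rewrite ?inE /alternating /= ?a2 ?a3.
Qed.

Lemma card_closed_walks6_eq_even :
  (#|[set c in closed_walks6 | c.1.1.2 == c.1.2.2]| <= D * #|closed_walks4|)%N.
Proof.
apply: leq_trans (leq_card_set_pair closed_walks4
  (fun c => indeg_le c.1.2)).
apply: (leq_card_surj_in (f := fun z : walk4 * V =>
  ((z.1.1, (z.2, z.1.1.2)), z.1.2))) => -[[[x1 y1] [x2 y2]] [x3 y3]].
rewrite !inE /alternating /= => /andP[+ /eqP eq_y]; rewrite -eq_y.
case/and3P=> /andP[a11 a21] /andP[_ a31] a3.
exists (((x1, y1), (x3, y3)), x2); rewrite ?inE /alternating //=.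
by rewrite a11 a31 a3 a21.
Qed.

(* Cauchy-Schwarz over the in-neighbours [x'] of [x] in [card_walks3]. *)
Lemma sum_card_walks3_diag_le :
  (\sum_x #|walks3 x x| ^ 2 <= D * #|closed_walks4|)%N.
Proof.
rewrite card_closed_walks4 big_distrr; apply: leq_sum => x _ /=.
rewrite card_walks3; apply: leq_trans (sum_Cauchy_Schwarz_nat _ _) _.
rewrite mulnC leq_mul2r; apply/orP; right; apply: leq_trans (indeg_le x).
by rewrite card_set_sum; apply: leq_sum => x' _; case: (a x' x).
Qed.

Lemma card_closed_walks6_antipodal :
  (#|[set c in closed_walks6 | c.1.1.1 == c.1.2.2]| <= D * #|closed_walks4|)%N.
Proof.
apply: leq_trans sum_card_walks3_diag_le.
rewrite -(card_set_pair_sqr (fun x => walks3 x x)).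
apply: (leq_card_surj_in (f := fun z : V * ((V * V) * (V * V)) =>
  (((z.1, z.2.1.1), (z.2.1.2, z.1)), (z.2.2.2, z.2.2.1))))
  => -[[[x1 y1] [x2 y2]] [x3 y3]].
rewrite !inE /alternating /= => /andP[+ /eqP eq_xy]; rewrite -eq_xy.
case/and3P=> /andP[a11 a21] /andP[a22 a32] /andP[a33 a13].
exists (x1, ((y1, x2), (y3, x3))); rewrite ?inE //=.
by rewrite a11 a21 a22 a13 a33 a32.
Qed.

Lemma card_coincident_closed_walks6 :
  (#|[set c in closed_walks6 | coincident c]| <=
   3 * (D * #|closed_walks4|))%N.
Proof.
set odd_eq := [set c in closed_walks6 | c.1.1.1 == c.1.2.1].
set even_eq := [set c in closed_walks6 | c.1.1.2 == c.1.2.2].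
set antipodal := [set c in closed_walks6 | c.1.1.1 == c.1.2.2].
have -> : [set c in closed_walks6 | coincident c] =
    odd_eq :|: even_eq :|: antipodal.
  apply/setP => -[[[x1 y1] [x2 y2]] [x3 y3]].
  by rewrite !inE -!andb_orr -orbA.
apply: leq_trans (leq_card_setU _ _) _; rewrite mulSnr.
rewrite leq_add ?card_closed_walks6_antipodal //.
apply: leq_trans (leq_card_setU _ _) _; rewrite mul2n -addnn.
by rewrite leq_add ?card_closed_walks6_eq_odd ?card_closed_walks6_eq_even.
Qed.

Lemma card_closed_walks6_le :
  irreflexive a ->
  (#|closed_walks6| <= #|[set c in closed_walks6 | uniq (walk6_vertices c)]| +
   9 * (D * #|closed_walks4|))%N.
Proof.
move=> irr_a.
rewrite -(cardsID [set c | uniq (walk6_vertices c)] closed_walks6).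
apply: leq_add; first by apply/subset_leq_card/subsetP => c; rewrite !inE.
set B := [set c in closed_walks6 | coincident c].
have in_B c : (c \in B) = (c \in closed_walks6) && coincident c.
  by rewrite in_set.
have in_rot X c : (c \in rot_walk6 @^-1: X) = (rot_walk6 c \in X).
  by rewrite in_set.
have cover_B : closed_walks6 :\: [set c | uniq (walk6_vertices c)] \subset
    B :|: rot_walk6 @^-1: B :|: rot_walk6 @^-1: (rot_walk6 @^-1: B).
  apply/subsetP => c; rewrite in_setD in_set => /andP[c_nuniq c_walk].
  rewrite !in_setU !in_rot !in_B !rot_closed_walks6 c_walk -orbA.
  exact: closed_walks6_not_uniq.
apply: leq_trans (subset_leq_card cover_B) _.
have card_rot (X : {set _}) : #|rot_walk6 @^-1: X| = #|X|.
  exact: card_preimset rot_walk6_inj.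
apply: leq_trans (leq_card_setU _ _) _; rewrite !card_rot.
have := card_coincident_closed_walks6; rewrite -/B => leB.
apply: (@leq_trans (3 * #|B|)).
  rewrite mulSnr leq_add2r mul2n -addnn -[X in (_ <= _ + X)%N]card_rot.
  exact: leq_card_setU.
by rewrite -[9%N]/(3 * 3)%N -mulnA leq_mul2l.
Qed.

End BoundedDegree.

End ClosedWalks.

Lemma card_uniq_closed_walks6_le (V : finType) (e a : rel V) :
  symmetric e -> subrel a e ->
  (#|[set c in closed_walks6 a | uniq (walk6_vertices c)]| <=
   6 ^ 6 * #|six_cycles e|)%N.
Proof.
move=> syme sub_ae; apply: leq_trans (card_ucycles6_le e).
rewrite -(card_imset _ (@walk6_vertices_inj V)).
apply/subset_leq_card/subsetP => _ /imsetP[[[[x1 y1] [x2 y2]] [x3 y3]] + ->].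
rewrite !inE /alternating /ucycleb /=.
case/andP=> /and3P[/andP[a11 a21] /andP[a22 a32] /andP[a33 a13]] ->.
rewrite (syme y1) (syme y2) (syme y3) !andbT.
by do !(apply/andP; split=> //); apply: sub_ae.
Qed.

(* The degenerate walks number at most [9 D Q <= 9 D (E H) ^ (1/2)], which is at
   most [H / 2 + 81 D ^ 2 E / 2]; here [E], [Q], [H] count the closed walks of
   [a] of length 2, 4 and 6. *)
Lemma card_closed_walks6_le_six_cycles (V : finType) (e a : rel V) (D : nat) :
  simple_graph e -> subrel a e -> (forall x, (deg e x <= D)%N) ->
  (#|closed_walks6 a| <=
   2 * (6 ^ 6 * #|six_cycles e|) + 81 * D ^ 2 * \sum_x deg a x)%N.
Proof.
move=> [syme irre] sub_ae degD.
have irra : irreflexive a.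
  by move=> x; apply/idP => /sub_ae; rewrite irre.
have outdeg_le x : (deg a x <= D)%N.
  apply: leq_trans (degD x).
  by apply/subset_leq_card/subsetP => y; rewrite !inE => /sub_ae.
have indeg_le y : (#|[set x | a x y]| <= D)%N.
  apply: leq_trans (degD y).
  by apply/subset_leq_card/subsetP => x; rewrite !inE syme => /sub_ae.
have le_uniq := card_uniq_closed_walks6_le syme sub_ae.
have le_closed := card_closed_walks6_le outdeg_le indeg_le irra.
set E := (\sum_x deg a x)%N; set Q := #|closed_walks4 a| in le_closed.
set H := #|closed_walks6 a| in le_closed *.
have : (2 * (9 * (D * Q)) <= 81 * D ^ 2 * E + H)%N.
  apply: leq_double_of_sqr; rewrite -[81%N]/(9 ^ 2)%N !expnMn.
  by rewrite mulnA -[leqRHS]mulnA leq_mul2l card_closed_walks4_sqr_le orbT.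
move: (6 ^ 6 * _)%N (81 * _ * _)%N (D * Q)%N le_uniq le_closed => N P DQ; lia.
Qed.

Lemma degree_ordering_deg_le (V : finType) (e gt : rel V) (u w : V) :
  degree_ordering e gt -> gt u w -> (deg e w <= deg e u)%N.
Proof.
case=> -[irr trans _] gt_deg gt_uw; rewrite leqNgt; apply/negP.
by move=> /gt_deg /(trans _ _ _ gt_uw); rewrite irr.
Qed.

Lemma card_capped_3walks_le_sum_deg (V : finType) (e gt : rel V) :
  symmetric e -> degree_ordering e gt ->
  (#|capped_3walks e gt| <=
   \sum_x \sum_(x0 | e x x0) \sum_(x2 | e x x2 && (deg e x2 <= deg e x0))
     deg e x2)%N.
Proof.
move=> syme ordP.
pose P (t : V * V * V) :=
  e t.1.1 t.1.2 && (e t.1.1 t.2 && (deg e t.2 <= deg e t.1.2)%N).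
apply: (@leq_trans #|[set z : V * V * V * V | P z.1 && e z.1.2 z.2]|).
  apply: (leq_card_surj_in (f := fun z : V * V * V * V =>
    [tuple z.1.1.2; z.1.1.1; z.1.2; z.2])) => x.
  case/tupleP: x => x0 x; case/tupleP: x => x1 x; case/tupleP: x => x2 x.
  case/tupleP: x => x3 x; rewrite (tuple0 x).
  rewrite inE /thead !(tnth_nth x0) /= !andbT.
  case/andP=> /and3P[e01 e12 e23] /and3P[_ gt02 _].
  exists (x1, x0, x2, x3); last exact: val_inj.
  by rewrite inE /P /= syme e01 e12 e23 (degree_ordering_deg_le ordP).
rewrite (card_set_pair (fun t y => P t && e t.2 y)) !pair_big_dep /=.
rewrite [leqRHS]big_mkcond; apply: leq_sum => t _; rewrite -/(P t).
by case: (P t) => //=; rewrite eq_card0 // => y; rewrite inE.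
Qed.

Lemma natr_card_walks3 (R : realDomainType) (V : finType) (a : rel V)
    (x u : V) :
  #|walks3 a x u|%:R = triple_kernel (fun x y => (a x y)%:R : R) x u.
Proof.
rewrite card_walks3 natr_sum; apply: eq_bigr => x' _.
rewrite natrM card_common_nbrs natr_sum; congr (_ * _).
by apply: eq_bigr => y _; rewrite natrM.
Qed.

Section SqrtDegreeSums.

Variables (R : rcfType) (V : finType) (e : rel V).

Definition sqrt_deg_sum (x : V) : R := \sum_(y | e x y) Num.sqrt (deg e y)%:R.

(* The [deg x2] continuations of a capped walk are at most
   [sqrt (deg x0) * sqrt (deg x2)] in number. *)
Lemma card_capped_3walks_le_sum_sqr (gt : rel V) :
  symmetric e -> degree_ordering e gt ->
  #|capped_3walks e gt|%:R <= \sum_x sqrt_deg_sum x ^+ 2.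
Proof.
move=> syme ordP.
have le_count := card_capped_3walks_le_sum_deg syme ordP.
rewrite -(ler_nat R) in le_count; apply: le_trans le_count _.
rewrite natr_sum; apply: ler_sum => x _.
rewrite natr_sum expr2 [leRHS]mulr_suml; apply: ler_sum => x0 _.
rewrite natr_sum mulr_sumr big_mkcondr; apply: ler_sum => x2 _ /=.
case: leqP => [le_deg|_]; last by rewrite mulr_ge0 ?sqrtr_ge0.
rewrite -[leLHS]sqr_sqrtr ?ler0n // expr2.
by rewrite ler_wpM2r ?sqrtr_ge0 // ler_sqrt ?ler_nat ?ler0n.
Qed.

Definition arcs_from (X : {set V}) : rel V := fun x y => (x \in X) && e x y.

Lemma deg_arcs_from (X : {set V}) (x : V) :
  deg (arcs_from X) x = if x \in X then deg e x else 0%N.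
Proof.
rewrite /deg /arcs_from; case: (x \in X) => //=.
by apply: eq_card0 => y; rewrite inE.
Qed.

Lemma sum_sqr_sqrt_deg_sum_cube_le (X : {set V}) :
  (\sum_(x in X) sqrt_deg_sum x ^+ 2) ^+ 3 <=
  (2 * #|edges e|%:R) ^+ 3 * #|closed_walks6 (arcs_from X)|%:R.
Proof.
pose A x y : R := (arcs_from X x y)%:R.
pose w y : R := Num.sqrt (deg e y)%:R.
have -> : \sum_(x in X) sqrt_deg_sum x ^+ 2 = \sum_x (\sum_y A x y * w y) ^+ 2.
  rewrite big_mkcond; apply: eq_bigr => x _; rewrite /A /arcs_from.
  case: (x \in X) => /=; last by rewrite big1 ?expr0n // => y _; rewrite mul0r.
  congr (_ ^+ 2); rewrite /sqrt_deg_sum big_mkcond; apply: eq_bigr => y _.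
  by case: (e x y); rewrite ?mul1r ?mul0r.
apply: le_trans (sum_sqr_kernel_cube_le A w) _.
have -> : \sum_x \sum_u triple_kernel A x u ^+ 2 =
    #|closed_walks6 (arcs_from X)|%:R.
  rewrite card_closed_walks6 natr_sum; apply: eq_bigr => x _.
  by rewrite natr_sum; apply: eq_bigr => u _; rewrite natrX natr_card_walks3.
have -> : \sum_y w y ^+ 2 = (\sum_y deg e y)%:R.
  by rewrite natr_sum; apply: eq_bigr => y _; rewrite sqr_sqrtr ?ler0n.
rewrite ler_wpM2r ?ler0n // lerXn2r ?nnegrE ?mulr_ge0 ?ler0n //.
by rewrite -natrM ler_nat sum_deg_le_edges.
Qed.

Definition heavy (c : R) : {set V} :=
  [set x | c * (deg e x)%:R <= sqrt_deg_sum x ^+ 2].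

Lemma sum_sqr_light_le (c : R) :
  0 <= c -> \sum_(x | x \notin heavy c) sqrt_deg_sum x ^+ 2 <=
  c * (2 * #|edges e|%:R).
Proof.
move=> c_ge0; apply: (@le_trans _ _ (\sum_x c * (deg e x)%:R)).
  rewrite big_mkcond; apply: ler_sum => x _; case: ifP => [|_].
    by rewrite inE -ltNge => /ltW.
  by rewrite mulr_ge0.
by rewrite -mulr_sumr -natr_sum ler_wpM2l // -natrM ler_nat sum_deg_le_edges.
Qed.

Lemma sum_deg_heavy_le (c : R) :
  c * (\sum_x deg (arcs_from (heavy c)) x)%:R <=
  \sum_(x in heavy c) sqrt_deg_sum x ^+ 2.
Proof.
rewrite natr_sum mulr_sumr [leRHS]big_mkcond; apply: ler_sum => x _.
by rewrite deg_arcs_from inE; case: ifP; rewrite ?mulr0.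
Qed.

Lemma sum_sqr_heavy_cube_le (c : R) (D : nat) :
  simple_graph e -> (forall x, (deg e x <= D)%N) -> 0 <= c ->
  c * (\sum_(x in heavy c) sqrt_deg_sum x ^+ 2) ^+ 3 <=
  (2 * #|edges e|%:R) ^+ 3 *
  (2 * 6 ^+ 6 * c * #|six_cycles e|%:R +
   81 * D%:R ^+ 2 * \sum_(x in heavy c) sqrt_deg_sum x ^+ 2).
Proof.
move=> simple_e degD c_ge0.
have sub_arcs : subrel (arcs_from (heavy c)) e by move=> x y /andP[].
have := card_closed_walks6_le_six_cycles simple_e sub_arcs degD.
rewrite -(ler_nat R) natrD !(natrX, natrM) => le_walks.
apply: (@le_trans _ _ (c * ((2 * #|edges e|%:R) ^+ 3 *
    #|closed_walks6 (arcs_from (heavy c))|%:R))).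
  by rewrite ler_wpM2l // sum_sqr_sqrt_deg_sum_cube_le.
rewrite mulrCA ler_wpM2l ?exprn_ge0 ?mulr_ge0 //.
apply: le_trans (ler_wpM2l c_ge0 le_walks) _.
set E : R := (\sum_x deg _ x)%:R.
have -> : c * (2 * (6 ^+ 6 * #|six_cycles e|%:R) + 81 * D%:R ^+ 2 * E) =
    2 * 6 ^+ 6 * c * #|six_cycles e|%:R + 81 * D%:R ^+ 2 * (c * E) by ring.
by rewrite lerD2l ler_wpM2l ?mulr_ge0 ?exprn_ge0 // sum_deg_heavy_le.
Qed.

End SqrtDegreeSums.

Lemma sum_sqr_heavy_le (R : rcfType) (V : finType) (e : rel V) (q : R) :
  simple_graph e ->
  1 <= q -> #|edges e|%:R = q ^+ 5 -> (max_deg e)%:R <= q ^+ 2 ->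
  \sum_(x in heavy e (q ^+ 3)) sqrt_deg_sum R e x ^+ 2 <=
  100 * (q ^+ 8 + #|six_cycles e|%:R).
Proof.
move=> simple_e q_ge1 m_eq degq.
set t := #|six_cycles e|%:R; set s := q ^+ 8 + t; set W := \sum_(x in _) _.
have q_gt0 : 0 < q by apply: lt_le_trans q_ge1.
have qX_ge0 n : 0 <= q ^+ n by rewrite exprn_ge0 // ltW.
have t_ge0 : 0 <= t by rewrite /t.
have s_ge0 : 0 <= s by rewrite addr_ge0.
have W_ge0 : 0 <= W by apply: sumr_ge0 => x _; apply: sqr_ge0.
have le_q16 : q ^+ 16 <= s ^+ 2.
  by rewrite (exprM q 8 2) lerXn2r ?nnegrE // lerDl.
have le_q15t : q ^+ 15 * t <= s ^+ 3.
  rewrite [leRHS]exprSr; apply: ler_pM => //; last by rewrite lerDr.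
  by apply: le_trans le_q16; rewrite ler_weXn2l.
have le_D : q ^+ 12 * (max_deg e)%:R ^+ 2 <= s ^+ 2.
  apply: le_trans le_q16; rewrite (exprD q 12 4) ler_wpM2l //.
  by rewrite (exprM q 2 2) lerXn2r ?nnegrE.
have degD x : (deg e x <= max_deg e)%N by apply: leq_bigmax.
have le_cube := sum_sqr_heavy_cube_le simple_e degD (qX_ge0 3).
have le_W3 : W ^+ 3 <= 16 * 6 ^+ 6 * s ^+ 3 + 648 * s ^+ 2 * W.
  rewrite -(ler_pM2l (exprn_gt0 3 q_gt0)); apply: le_trans le_cube _.
  rewrite -/W -/t m_eq.
  have -> : (2 * q ^+ 5) ^+ 3 * (2 * 6 ^+ 6 * q ^+ 3 * t +
        81 * (max_deg e)%:R ^+ 2 * W) =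
      q ^+ 3 * (16 * 6 ^+ 6 * (q ^+ 15 * t) +
        648 * (q ^+ 12 * (max_deg e)%:R ^+ 2) * W) by ring.
  rewrite ler_wpM2l //; apply: lerD.
    by rewrite ler_wpM2l // mulr_ge0 ?exprn_ge0.
  by rewrite ler_wpM2r // ler_wpM2l.
by apply: cube_le_cubic_form le_W3; rewrite ?mulr_ge0 ?exprn_ge0 //; lra.
Qed.

Lemma card_capped_3walks_le (R : rcfType) (V : finType) (e gt : rel V)
    (q : R) :
  simple_graph e -> degree_ordering e gt ->
  1 <= q -> #|edges e|%:R = q ^+ 5 -> (max_deg e)%:R <= q ^+ 2 ->
  #|capped_3walks e gt|%:R <= 102 * (q ^+ 8 + #|six_cycles e|%:R).
Proof.
move=> simple_e ordP q_ge1 m_eq degq.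
have q_ge0 : 0 <= q by apply: le_trans q_ge1.
have le_heavy := sum_sqr_heavy_le simple_e q_ge1 m_eq degq.
have le_light := sum_sqr_light_le e (exprn_ge0 3 q_ge0).
have light_eq : q ^+ 3 * (2 * #|edges e|%:R) = 2 * q ^+ 8 by rewrite m_eq; ring.
have t_ge0 : 0 <= #|six_cycles e|%:R :> R by [].
apply: le_trans (card_capped_3walks_le_sum_sqr R (proj1 simple_e) ordP) _.
rewrite (bigID (mem (heavy e (q ^+ 3)))) /=.
by lra.
Qed.

Theorem lemma4p2 (R : realType) :
  exists (C : R) (k : nat), 0 < C /\
    forall (V : finType) (e gt : rel V),
      simple_graph e ->
      degree_ordering e gt ->
      (#|V| <= #|edges e|)%N ->
      (max_deg e)%:R <= (#|edges e|%:R : R) `^ (2 / 5) ->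
      #|capped_3walks e gt|%:R <=
        C * ln (#|V|%:R : R) ^+ k
          * ((#|edges e|%:R : R) `^ (8 / 5) + #|six_cycles e|%:R).
Proof.
exists 102, 0%N; split=> // V e gt simple_e ordP leVm le_deg.
rewrite expr0 mulr1.
have [m0|m_gt0] := posnP #|edges e|.
  have V0 : #|V| = 0%N by apply/eqP; rewrite -leqn0 -m0.
  rewrite eq_card0 ?mulr_ge0 ?addr_ge0 ?powR_ge0 // => x.
  by have := max_card (pred1 (thead x)); rewrite V0 card1.
pose q : R := #|edges e|%:R `^ (1 / 5).
have powR_eq n : (#|edges e|%:R : R) `^ (n%:R / 5) = q ^+ n.
  by rewrite -powR_mulrn ?powR_ge0 // -powRrM; congr (_ `^ _); ring.
have q_ge1 : 1 <= q.
  by rewrite -[leLHS](powRr0 #|edges e|%:R) ler_powR ?ler1n // divr_ge0.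
rewrite (powR_eq 2) in le_deg; rewrite (powR_eq 8).
apply: card_capped_3walks_le => //.
by rewrite -powR_eq divff ?pnatr_eq0 // powRr1.
Qed.
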